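(* Let $L$ and $K$ be bounded distributive meet semi-lattices and let $h:L\to K$ be a meet semi-lattice homomorphism preserving top. Let $R_h\subseteq K_*\times L_*$ be defined by $xR_hy$ iff $h^{-1}(x)\subseteq y$. Then: (1) $h$ is one-to-one iff $R_h$ is onto; (2) $h$ is onto iff $R_h$ is 1-1.
   Context: A bounded distributive meet semi-lattice is a poset with top and bottom in which any two elements have a meet, such that $b_1\wedge b_2\le a$ implies $a=c_1\wedge c_2$ for some $c_1\ge b_1$, $c_2\ge b_2$. A filter is a nonempty upset closed under $\wedge$; a prime filter is a filter $F\ne L$ such that $F_1\cap F_2\subseteq F$ for filters $F_1,F_2$ implies $F_1\subseteq F$ or $F_2\subseteq F$; $L_+$ is the set of prime filters; $\sigma(a)=\{y\in L_+:a\in y\}$; $D(L)$ is the lattice of finite unions of sets $\sigma(a)$; a filter $G$ is optimal if $G=\sigma^{-1}(P)$ for a prime filter $P$ of $D(L)$; $L_*$ is the set of optimal filters ordered by $\subseteq$; $\phi(a)=\{y\in L_*:a\in y\}$; and $(L_* )^*$, the set of admissible clopen upsets of $L_*$, equals $\{\phi(a):a\in L\}$. Similarly for $K$. For a relation $R\subseteq X\times Y$ between these spaces, $R[x]=\{y:xRy\}$, $R[U]=\bigcup_{x\in U}R[x]$, ${\uparrow}y=\{z:y\subseteq z\}$. $R$ is called onto if for each $y\in Y$ there is $x\in X$ with $R[x]={\uparrow}y$; $R$ is called 1-1 if for each $x\in X$ and each admissible clopen upset $U$ of $X$ with $x\notin U$, there is an admissible clopen upset $V$ of $Y$ such that $R[U]\subseteq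 V$ and $R[x]\not\subseteq V$. (Here $X=K_*$, $Y=L_*$, and the admissible clopen upsets are $\{\phi(b):b\in K\}$ and $\{\phi(a):a\in L\}$ respectively.) *)

(* Defs.v *)
From HB Require Import structures.
From mathcomp Require Import all_boot all_order.
From mathcomp Require Import boolp classical_sets.

Set Implicit Arguments.
Unset Strict Implicit.
Unset Printing Implicit Defensive.

Import Order.TTheory.

Local Open Scope classical_set_scope.

Section Filters.
Context {d : Order.disp_t} {L : meetSemilatticeType d}.

Definition distributive_msl :=
  forall a b1 b2 : L, (b1 `&` b2 <= a)%O ->
    exists c1 c2 : L, [/\ (b1 <= c1)%O, (b2 <= c2)%O & a = (c1 `&` c2)%O].

Definition msl_filter (F : set L) : Prop :=
  [/\ F !=set0,
      forall a b, F a -> (a <= b)%O -> F b &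
      forall a b, F a -> F b -> F (a `&` b)%O].

Definition prime_filter (F : set L) : Prop :=
  [/\ msl_filter F, F <> setT &
      forall F1 F2, msl_filter F1 -> msl_filter F2 ->
        F1 `&` F2 `<=` F -> F1 `<=` F \/ F2 `<=` F].

End Filters.

Arguments distributive_msl {d} L.

Section Spectrum.
Context {d : Order.disp_t} (L : meetSemilatticeType d).

Definition primeSpec : Type := {y : set L | prime_filter y}.

Definition sigma (a : L) : set primeSpec := [set y | sval y a].

Definition fin_union_sigma : {pred set primeSpec} :=
  [pred A | `[< exists s : seq L, A = \big[setU/set0]_(a <- s) sigma a >]].

Lemma sigmaI a b : sigma a `&` sigma b = sigma (a `&` b)%O.
Proof.
apply/seteqP; split=> [y [ya yb]|y yab]; have [[_ up cap] _ _] := svalP y.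
  exact: cap.
by split; apply: up yab _; rewrite ?leIl ?leIr.
Qed.

Lemma fin_union_sigmaU : {in fin_union_sigma &, forall A B,
  (A `|` B)%O \in fin_union_sigma}.
Proof.
move=> A B /asboolP[s ->] /asboolP[t ->]; apply/asboolP; exists (s ++ t).
by rewrite big_cat.
Qed.

Lemma fin_union_sigmaI : {in fin_union_sigma &, forall A B,
  (A `&` B)%O \in fin_union_sigma}.
Proof.
move=> A B /asboolP[s ->] /asboolP[t ->]; apply/asboolP.
exists [seq (a `&` b)%O | a <- s, b <- t].
rewrite big_allpairs_dep -[LHS]/(_ `&` _) big_distrl /=.
apply: eq_bigr => a _; rewrite big_distrr /=.
by apply: eq_bigr => b _; rewrite sigmaI.
Qed.

HB.instance Definition _ := Order.isLatticeClosed.Build set_display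
  (set primeSpec) fin_union_sigma fin_union_sigmaI fin_union_sigmaU.

Record envelope : Type :=
  Envelope { envelope_val : set primeSpec; _ : envelope_val \in fin_union_sigma }.

HB.instance Definition _ := [isSub for envelope_val].
HB.instance Definition _ := [Choice of envelope by <:].
HB.instance Definition _ :=
  [SubChoice_isSubLattice of envelope by <: with set_display].

Lemma sigma_fin_union a : sigma a \in fin_union_sigma.
Proof. by apply/asboolP; exists [:: a]; rewrite big_seq1. Qed.

Definition sigmaD (a : L) : envelope := Envelope (sigma_fin_union a).

Definition optimal_filter (G : set L) : Prop :=
  msl_filter G /\
  exists2 P : set envelope, prime_filter P & G = sigmaD @^-1` P.

Definition optSpec : Type := {y : set L | optimal_filter y}.

Definition phi (a : L) : set optSpec := [set y | sval y a].

(* The admissible clopen upsets of the dual space are exactly the sets phi a. *)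
Definition admissible : set (set optSpec) := range phi.

Definition upset_of (y : optSpec) : set optSpec := [set z | sval y `<=` sval z].

End Spectrum.

Section Relations.
Context {dK dL : Order.disp_t}.
Context {K : meetSemilatticeType dK} {L : meetSemilatticeType dL}.
Implicit Type R : optSpec K -> optSpec L -> Prop.

Definition rel_img R (x : optSpec K) : set (optSpec L) := [set y | R x y].

Definition rel_imgU R (U : set (optSpec K)) : set (optSpec L) :=
  \bigcup_(x in U) rel_img R x.

Definition rel_onto R : Prop :=
  forall y : optSpec L, exists x : optSpec K, rel_img R x = upset_of y.

Definition rel_one_one R : Prop :=
  forall (x : optSpec K) (U : set (optSpec K)), admissible U -> ~ U x ->
    exists V : set (optSpec L),
      [/\ admissible V, rel_imgU R U `<=` V & ~ (rel_img R x `<=` V)].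

Definition dual_rel (h : L -> K) : optSpec K -> optSpec L -> Prop :=
  fun x y => h @^-1` sval x `<=` sval y.

End Relations.

(* Main.v *)
Require Import Defs.
From mathcomp Require Import all_boot all_order.
From mathcomp Require Import boolp classical_sets.

(** Optimal filters are governed by one fact: [sigma b] is covered by
    [sigma a_1, ..., sigma a_n] iff every common upper bound of the [a_i] is
    above [b].  Together with the prime filter theorem in the distributive
    lattice [D(L)], it separates a filter [F] from a set [S] by an optimal
    filter as soon as no element of [F] lies below all upper bounds of a finite
    part of [S].  In particular every filter is the intersection of the optimal
    filters containing it.

    If [h] is injective and [y] is optimal, separating the filter generated by
    [h(y)] from [h(L \ y)] yields [x] with [h^-1(x) = y].  If [R_h] is 1-1,
    the filter generated by the [h a] above [b] must contain [b], for otherwise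
    an optimal filter containing it and missing [b] would contradict the
    hypothesis.  The two converses only use that the filter [h^-1(x)] is an
    intersection of optimal filters. *)

Set Implicit Arguments.
Unset Strict Implicit.
Unset Printing Implicit Defensive.

Import Order.TTheory.

Local Open Scope classical_set_scope.

(** * Prime filters and the prime filter theorem *)

Section PrimeFilters.
Context {d : Order.disp_t} {L : meetSemilatticeType d}.
Implicit Types (a b c : L) (F I : set L) (s : seq L).

Lemma msl_filter_principal a : msl_filter [set b | (a <= b)%O].
Proof.
split; first by exists a => /=.
- by move=> b c /= ab bc; exact: le_trans bc.
- by move=> b c /= ab ac; rewrite lexI ab ac.
Qed.

Lemma msl_filter_join F a : msl_filter F ->
  msl_filter [set b | exists2 f, F f & (f `&` a <= b)%O].
Proof.
move=> [[f Ff] Fup FI]; split.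
- by exists (f `&` a)%O, f.
- by move=> b c /= [g Fg gb] bc; exists g => //; exact: le_trans bc.
- move=> b c /= [g Fg gb] [g' Fg' gc]; exists (g `&` g')%O; first exact: FI.
  rewrite lexI; apply/andP; split.
    by apply: le_trans gb; rewrite leI2 // leIl.
  by apply: le_trans gc; rewrite leI2 // leIr.
Qed.

Lemma maximal_filter F I : msl_filter F -> F `&` I = set0 ->
  exists G, [/\ msl_filter G, F `<=` G, G `&` I = set0 &
    forall H, msl_filter H -> G `<=` H -> H `&` I = set0 -> H `<=` G].
Proof.
move=> Ff FI0.
(* Zorn is applied to the sets [X] to be added to [F], not to the filters themselves: the empty
   chain has union [set0], which is then allowed. *)
pose P := [set X : set L | msl_filter (F `|` X) /\ (F `|` X) `&` I = set0].
have [] := @Zorn_bigcup L P.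
  move=> C CP Ctot; have [[f0 Ff0] Fup FI] := Ff; split.
    split; first by exists f0; left.
    - move=> a b [Fa|[X CX Xa]] ab; first by left; exact: Fup ab.
      have [[_ Xup _] _] := CP _ CX.
      by have [Fb|Xb] := Xup a b (or_intror Xa) ab; [left|right; exists X].
    - have inC X a b : C X -> (F `|` X) a -> (F `|` X) b ->
          (F `|` \bigcup_(X in C) X) (a `&` b)%O.
        move=> CX Xa Xb; have [[_ _ XI] _] := CP _ CX.
        by have [?|?] := XI _ _ Xa Xb; [left|right; exists X].
      move=> a b [Fa|[X CX Xa]] [Fb|[Y CY Yb]].
      + by left; exact: FI.
      + by apply: (inC Y) => //; [left|right].
      + by apply: (inC X) => //; [right|left].
      + have [XY|YX] := Ctot _ _ CX CY.
          by apply: (inC Y) => //; right=> //; exact: XY.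
        by apply: (inC X) => //; right=> //; exact: YX.
  rewrite -subset0 => a [[Fa|[X CX Xa]] Ia].
    by rewrite -FI0.
  by have [_ <-] := CP _ CX; split=> //; right.
move=> A [[Af A0] Amax]; exists (F `|` A); split=> //.
move=> H Hf FAH H0; have FH : F `|` H = H.
  by apply/setUidPr => a Fa; apply: FAH; left.
apply: contrapT => HnA; apply: (Amax H); last by split; rewrite FH.
split=> [|HA]; first by move=> a Aa; apply: FAH; right.
by apply: HnA => a Ha; right; exact: HA.
Qed.

Hypothesis distr : distributive_msl L.

(** A filter [G] maximal among those containing [F] and missing the directed set [I] is prime:
    adjoining to [G] an element outside it yields a filter that meets [I]. *)
Lemma prime_filter_separation F I :
    msl_filter F -> I !=set0 ->
    (forall a b, I a -> I b -> exists2 c, I c & (a <= c)%O && (b <= c)%O) ->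
    F `&` I = set0 ->
  exists G, [/\ prime_filter G, F `<=` G & G `&` I = set0].
Proof.
move=> Ff [i0 Ii0] Idir /(maximal_filter Ff)[G [Gf FG G0 Gmax]].
exists G; split=> //; split=> //.
  by move=> GT; rewrite -[False]/(set0 i0) -G0 GT.
have meetI x : ~ G x -> exists f c, [/\ G f, I c & (f `&` x <= c)%O].
  move=> nGx; apply: contrapT => nex; apply: nGx.
  have Hf := msl_filter_join x Gf; have [[g Gg] Gup GI] := Gf.
  apply: (Gmax _ Hf) => [a Ga||].
  - by exists a => //; exact: leIl.
  - rewrite -subset0 => c [[f Gf' fc] Ic].
    by apply: nex; exists f, c.
  - by exists g => //; exact: leIr.
move=> F1 F2 [_ F1up _] [_ F2up _] F12.
apply: contrapT => /not_orP[/existsNP[x1 /not_implyP[F1x1 nGx1]]].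
move=> /existsNP[x2 /not_implyP[F2x2 nGx2]].
have [f1 [c1 [Gf1 Ic1 fc1]]] := meetI _ nGx1.
have [f2 [c2 [Gf2 Ic2 fc2]]] := meetI _ nGx2.
have [c Ic /andP[c1c c2c]] := Idir _ _ Ic1 Ic2.
have [_ Gup GI] := Gf.
(* Splitting [c], then its factor [v], gives [c] as the meet of [u], [u'] and [w], with [u] and [u']
   in [G] and [w] above both [x1] and [x2]. Hence [w] lies in [F1] and [F2], so in [G], and then so
   does [c]. *)
have [u [v [f1u x1v cE]]] := distr (le_trans fc1 c1c).
have f2v : (f2 `&` x2 <= v)%O.
  by apply: le_trans fc2 (le_trans c2c _); rewrite cE leIr.
have [u' [w [f2u x2w vE]]] := distr f2v.
have Gw : G w.
  apply: F12; split; last exact: F2up x2w.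
  by apply: F1up F1x1 _; apply: le_trans x1v _; rewrite vE leIr.
suff : (G `&` I) c by rewrite G0.
split=> //; rewrite cE vE; apply: (GI); first exact: Gup f1u.
by apply: GI => //; exact: Gup f2u.
Qed.

End PrimeFilters.

(** The upper bounds of [a :: s] form the intersection of two filters, the principal one of [a] and
    the upper bounds of [s], so primeness allows induction on [s]. The top is an explicit [t] so
    that this serves both [L] and [envelope L]. *)
Lemma prime_filter_ubound (d : Order.disp_t) (L : meetSemilatticeType d)
    (t : L) (F : set L) (s : seq L) :
    (forall a, (a <= t)%O) -> prime_filter F ->
    (forall c, (forall a, a \in s -> (a <= c)%O) -> F c) ->
  exists2 a, a \in s & F a.
Proof.
move=> le_t [Ff FT Fprime].
elim: s => [Fub|a s IHs Fub].
  by case: FT; apply/seteqP; split=> // c _; exact: Fub.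
pose U := [set c : L | forall a, a \in s -> (a <= c)%O].
have Uf : msl_filter U.
  split; first by exists t => b _; exact: le_t.
  - by move=> b c Ub bc e es; apply: le_trans bc; exact: Ub.
  - by move=> b c Ub Uc e es; rewrite lexI Ub // Uc.
have [|aF|UF] := Fprime _ _ (msl_filter_principal a) Uf.
- move=> c [/= ac Uc]; apply: Fub => b.
  by rewrite inE => /orP[/eqP->//|]; exact: Uc.
- by exists a; rewrite ?mem_head //; apply: aF => /=.
- have [b bs Fb] := IHs UF.
  by exists b; rewrite // inE bs orbT.
Qed.

(** * The lattice D(L) and its distributivity *)

Section Envelope.
Context {d : Order.disp_t} {L : meetSemilatticeType d}.
Implicit Types A B C : envelope L.

Lemma le_envelope A B :
  (A <= B)%O <-> envelope_val A `<=` envelope_val B.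
Proof. by rewrite -subsetEset. Qed.

Lemma envelope_valI A B :
  envelope_val (A `&` B)%O = envelope_val A `&` envelope_val B.
Proof. by []. Qed.

Lemma envelope_valU A B :
  envelope_val (A `|` B)%O = envelope_val A `|` envelope_val B.
Proof. by []. Qed.

Lemma envelope_distributive : distributive_msl (envelope L).
Proof.
move=> A B1 B2 /le_envelope; rewrite envelope_valI => B12A.
exists (A `|` B1)%O, (A `|` B2)%O; split; rewrite ?leUr //; apply: val_inj.
rewrite [RHS]envelope_valI !envelope_valU -setUIr.
by apply/esym/setUidPl.
Qed.

Lemma sigmaDI (a b : L) : (sigmaD a `&` sigmaD b)%O = sigmaD (a `&` b)%O.
Proof. by apply: val_inj; exact: sigmaI. Qed.

Lemma sigmaD_le (a b : L) : (a <= b)%O -> (sigmaD a <= sigmaD b)%O.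
Proof. by move=> /meet_l ab; rewrite -{1}ab -sigmaDI leIr. Qed.

Lemma bigsigmaP (s : seq L) (x : primeSpec L) :
  (\big[setU/set0]_(a <- s) sigma a) x <-> exists2 a, a \in s & sval x a.
Proof. by rewrite -bigcup_seq; split=> -[a]; exists a. Qed.

End Envelope.

(** * Optimal filters and their separation *)

Section OptimalFilters.
Context {d : Order.disp_t} {L : tbMeetSemilatticeType d}.
Implicit Types (a b c : L) (F S : set L) (s : seq L).

Lemma msl_filter_top F : msl_filter F -> F \top%O.
Proof. by move=> [[a Fa] up _]; apply: up Fa _; exact: lex1. Qed.

Lemma le_sigmaD_top (A : envelope L) : (A <= sigmaD \top)%O.
Proof.
apply/le_envelope => x _; have [xf _ _] := svalP x.
exact: msl_filter_top.
Qed.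

Lemma optimal_filter_preimage (P : set (envelope L)) :
  prime_filter P -> optimal_filter (@sigmaD d L @^-1` P).
Proof.
move=> Pp; split; last by exists P.
have [[[A PA] Pup PI] _ _] := Pp; split.
- by exists \top%O; apply: Pup PA _; exact: le_sigmaD_top.
- by move=> a b /= Pa ab; apply: Pup Pa _; exact: sigmaD_le.
- by move=> a b /= Pa Pb; rewrite /= -sigmaDI; exact: PI.
Qed.

(** Primeness is used twice: at each point [x] of [sigma b], to see that the sets [sigma a] cover
    it, and for [P] in the envelope, to pick one of them. *)
Lemma optimal_filter_ubound F s b : optimal_filter F -> F b ->
    (forall c, (forall a, a \in s -> (a <= c)%O) -> (b <= c)%O) ->
  exists2 a, a \in s & F a.
Proof.
move=> [_ [P Pp ->]] /= Pb sb; have [[_ Pup _] _ _] := Pp.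
have [|_ /mapP[a as_ ->] Pa] :=
    @prime_filter_ubound _ _ _ P (map (@sigmaD d L) s) le_sigmaD_top Pp.
  move=> C leC; apply: Pup Pb _; apply/le_envelope => x xb.
  have [|a as_ xa] := @prime_filter_ubound _ _ _ (sval x) s lex1 (svalP x).
    by have [[_ xup _] _ _] := svalP x; move=> c /sb; exact: xup.
  have /le_envelope leaC := leC _ (map_f (@sigmaD d L) as_).
  exact: leaC.
by exists a.
Qed.

Hypothesis distr : distributive_msl L.

Lemma optimal_separation F S : msl_filter F ->
    (forall a s, F a -> (forall b, b \in s -> S b) ->
      exists2 c, (forall b, b \in s -> (b <= c)%O) & ~ (a <= c)%O) ->
  exists x : optSpec L, F `<=` sval x /\ sval x `&` S = set0.
Proof.
move=> Ff FS; have [_ Fup FI] := Ff.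
(* [FD] is the filter generated by the image of [F]; [ID] collects the finite unions of [sigma a]
   with [a] in [S], directed by concatenation of lists. *)
pose FD := [set A : envelope L | exists2 a, F a & (sigmaD a <= A)%O].
pose ID := [set A : envelope L | exists2 s, (forall b, b \in s -> S b) &
  envelope_val A = \big[setU/set0]_(a <- s) sigma a].
have union_mem s : \big[setU/set0]_(a <- s) sigma a \in @fin_union_sigma d L.
  by apply/asboolP; exists s.
have [|||| P [Pp FP P0]] :=
    @prime_filter_separation _ _ envelope_distributive FD ID.
- split; first by exists (sigmaD \top%O), \top%O; [exact: msl_filter_top|].
  + by move=> A B [a Fa aA] AB; exists a => //; exact: le_trans AB.
  + move=> A B [a Fa aA] [b Fb bB]; exists (a `&` b)%O; first exact: FI.
    by rewrite -sigmaDI leI2.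
- by exists (Envelope (union_mem [::])), [::].
- move=> A B [s sS As] [t tS Bt]; exists (Envelope (union_mem (s ++ t))).
    by exists (s ++ t) => // b; rewrite mem_cat => /orP[/sS|/tS].
  apply/andP; split; apply/le_envelope; rewrite ?As ?Bt /= big_cat.
    exact: subsetUl.
  exact: subsetUr.
(* A common element would make the sets [sigma b], [b] in [s], cover [sigma a]. A prime filter
   containing [a] but not the bound [c] of [s] is a point of [sigma a] outside all of them. *)
- rewrite -subset0 => A [[a Fa /le_envelope aA] [s sS As]].
  have [c sc nac] := FS _ _ Fa sS.
  have [|||| G [Gp aG G0]] := @prime_filter_separation _ _ distr
    [set b | (a <= b)%O] [set c].
  + exact: msl_filter_principal.
  + by exists c.
  + by move=> _ _ -> ->; exists c; rewrite ?lexx.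
  + by rewrite -subset0 => b [/= ab bc]; apply: nac; rewrite -bc.
  have [[_ Gup _] _ _] := Gp.
  have /aA : sigma a (exist _ G Gp) by apply: aG => /=.
  rewrite As => /bigsigmaP[b bs /= Gb].
  have: (G `&` [set c]) c by split=> //; apply: Gup Gb _; exact: sc.
  by rewrite G0.
exists (exist _ _ (optimal_filter_preimage Pp)) => /=; split.
  by move=> a Fa; apply: FP; exists a.
rewrite -subset0 => a [/= Pa Sa].
suff : (P `&` ID) (sigmaD a) by rewrite P0.
split=> //; exists [:: a]; last by rewrite big_seq1.
by move=> b; rewrite inE => /eqP->.
Qed.

Lemma optimal_separation1 F c : msl_filter F -> ~ F c ->
  exists2 x : optSpec L, F `<=` sval x & ~ sval x c.
Proof.
move=> Ff nFc; have [_ Fup _] := Ff.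
have [|x [Fx x0]] := @optimal_separation F [set c] Ff.
  move=> a s Fa sc; exists c => [b /sc ->//|ac].
  by apply: nFc; exact: Fup ac.
by exists x => // xc; rewrite -[False]/(set0 c) -x0.
Qed.

Lemma optimal_separation_le a b : ~ (a <= b)%O ->
  exists2 x : optSpec L, sval x a & ~ sval x b.
Proof.
move=> nab.
have [x ax nxb] := @optimal_separation1 [set c | (a <= c)%O] b
  (msl_filter_principal a) nab.
by exists x => //; apply: ax => /=.
Qed.

End OptimalFilters.

(** * The relation dual to a homomorphism *)

Section DualRelation.
Context {dL dK : Order.disp_t}.
Context {L : tbMeetSemilatticeType dL} {K : tbMeetSemilatticeType dK}.
Hypotheses (distrL : distributive_msl L) (distrK : distributive_msl K).
Variable h : L -> K.
Hypothesis hI : forall a b : L, h (a `&` b)%O = (h a `&` h b)%O.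
Hypothesis hT : h \top%O = \top%O.

Lemma msl_hom_homo a b : (a <= b)%O -> (h a <= h b)%O.
Proof. by move=> /meet_l ab; rewrite -{1}ab hI leIr. Qed.

Lemma msl_filter_preimage (F : set K) : msl_filter F -> msl_filter (h @^-1` F).
Proof.
move=> Ff; have [_ Fup FI] := Ff; split.
- by exists \top%O; rewrite /= hT; exact: msl_filter_top.
- by move=> a b /= Fa ab; apply: Fup Fa _; exact: msl_hom_homo.
- by move=> a b /= Fa Fb; rewrite /= hI; exact: FI.
Qed.

(** This turns both conditions on the relation into membership statements. If [h a] is not in [x],
    some optimal [y] contains the filter [h @^-1] of [x] and misses [a]. *)
Lemma dual_rel_sub_phi (x : optSpec K) (a : L) :
  rel_img (dual_rel h) x `<=` phi a <-> sval x (h a).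
Proof.
split=> [xa|xha y]; last by move=> xy; exact: xy.
apply: contrapT => nxha; have [xf _] := svalP x.
have [y xy nya] := optimal_separation1 distrL (msl_filter_preimage xf) nxha.
by apply: nya; exact: xa.
Qed.

Lemma injective_rel_onto : injective h -> rel_onto (dual_rel h).
Proof.
move=> hinj y; have [yf yP] := svalP y; have [[a0 ya0] yup yI] := yf.
pose F := [set b : K | exists2 a, sval y a & (h a <= b)%O].
have Ff : msl_filter F.
  split; first by exists (h a0), a0.
  - by move=> b c [a ya ab] bc; exists a => //; exact: le_trans bc.
  - move=> b c [a ya ab] [a' ya' ac]; exists (a `&` a')%O; first exact: yI.
    by rewrite hI leI2.
have [|x [Fx x0]] := @optimal_separation _ _ distrK F (h @` ~` sval y) Ff.
  move=> b s [a ya hab] sS; apply: contrapT => nex.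
  (* The list [s] is lifted to a list [t] outside [y]. An injective [h] reflects the order, so every
     upper bound of [t] is above [a], which forces a member of [t] into [y]. *)
  have [t ty sE] : exists2 t, (forall a, a \in t -> ~ sval y a) & s = map h t.
    elim: s sS {nex} => [|c s IHs] sS; first by exists [::].
    have [e nye <-] := sS c (mem_head _ _).
    have [|t ty ->] := IHs; first by move=> f fs; apply: sS; rewrite inE fs orbT.
    by exists (e :: t) => // f; rewrite inE => /orP[/eqP->|/ty].
  have [|e et ye] := @optimal_filter_ubound _ _ _ t a (svalP y) ya.
    move=> c tc; apply/meet_idPl/hinj; rewrite hI; apply/meet_idPl.
    apply: contrapT => nhac; apply: nex; exists (h c).
      by rewrite sE => _ /mapP[e et ->]; apply: msl_hom_homo; exact: tc.
    by move=> bc; apply: nhac; exact: le_trans bc.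
  exact: ty ye.
have xE : h @^-1` sval x = sval y.
  apply/seteqP; split=> a /= ha; last by apply: Fx; exists a.
  apply: contrapT => nya; suff : (sval x `&` (h @` ~` sval y)) (h a).
    by rewrite x0.
  by split=> //; exists a.
by exists x; rewrite /rel_img /dual_rel xE.
Qed.

(** If [h a = h b] and [y] contains [a] but not [b], take [x] with image the upset of [y]. That
    upset lies in [phi a], so [x] contains [h a = h b], which puts [b] in [y]. *)
Lemma rel_onto_injective : rel_onto (dual_rel h) -> injective h.
Proof.
move=> onto.
suff hle a b : h a = h b -> (a <= b)%O.
  by move=> a b hab; apply: le_anti; rewrite !hle.
move=> hab; apply: contrapT => /(optimal_separation_le distrL)[y ya nyb].
have [x xE] := onto y.
have xha : sval x (h a).
  by apply/dual_rel_sub_phi; rewrite xE => z; apply.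
have : rel_img (dual_rel h) x y by rewrite xE.
by move=> /(_ b); rewrite /= -hab => /(_ xha).
Qed.

Lemma surjective_rel_one_one :
  (forall b, exists a, h a = b) -> rel_one_one (dual_rel h).
Proof.
move=> hsurj x _ [b _ <-] nxb; have [a hab] := hsurj b.
exists (phi a); split; first by exists a.
  move=> y [x' x'b]; have := (dual_rel_sub_phi x' a).2; rewrite hab.
  by apply.
by rewrite dual_rel_sub_phi hab.
Qed.

Lemma rel_one_one_surjective :
  rel_one_one (dual_rel h) -> forall b, exists a, h a = b.
Proof.
move=> inj b; pose F := [set c : K | exists2 a, (b <= h a)%O & (h a <= c)%O].
have Ff : msl_filter F.
  split; first by exists \top%O, \top%O; rewrite ?hT ?lex1.
  - by move=> c e [a ba ac] ce; exists a => //; exact: le_trans ce.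
  - move=> c e [a ba ac] [a' ba' ae]; exists (a `&` a')%O.
      by rewrite hI lexI ba.
    by rewrite hI leI2.
have [[a ba ab]|nFb] := pselect (F b); first by exists a; apply: le_anti; rewrite ab.
have [x Fx nxb] := optimal_separation1 distrK Ff nFb.
have [|V [[a _ <-] bV]] := inj x (phi b) _ nxb; first by exists b.
rewrite dual_rel_sub_phi => -[]; apply: Fx; exists a => //.
(* The inclusion of the image of [phi b] in [phi a] forces [b] below [h a]: any optimal filter
   containing [b] contains [h a]. *)
apply: contrapT => /(optimal_separation_le distrK)[x' x'b nx'a].
by apply/nx'a/dual_rel_sub_phi => y x'y; apply: bV; exists x'.
Qed.

End DualRelation.

Theorem theorem11p16 (dL dK : Order.disp_t)
    (L : tbMeetSemilatticeType dL) (K : tbMeetSemilatticeType dK)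
    (distrL : distributive_msl L) (distrK : distributive_msl K)
    (h : L -> K)
    (hI : forall a b : L, h (Order.meet a b) = Order.meet (h a) (h b))
    (hT : h Order.top = Order.top) :
  (injective h <-> rel_onto (dual_rel h)) /\
  ((forall b : K, exists a : L, h a = b) <-> rel_one_one (dual_rel h)).
Proof.
split; split.
- exact: injective_rel_onto.
- exact: rel_onto_injective.
- exact: surjective_rel_one_one.
- exact: rel_one_one_surjective.
Qed.
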